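(* There exists a countable commutative (and hence Clifford) Hausdorff topological inverse semigroup $S$ such that (i) $S$ is locally compact and Polish; (ii) the semilattice $E(S)$ is compact; (iii) $S$ cannot be topologically embedded into $\mathbb{N}^{\mathbb{N}}$.
   Context: An inverse semigroup is a semigroup $S$ such that for each $x\in S$ there is a unique $x^{-1}\in S$ with $xx^{-1}x=x$ and $x^{-1}xx^{-1}=x^{-1}$; it is Clifford if $xx^{-1}=x^{-1}x$ for all $x\in S$. A topological inverse semigroup is an inverse semigroup with a topology for which both multiplication and inversion are continuous. $E(S)=\{e\in S: e^2=e\}$ is the semilattice of idempotents of $S$, with the subspace topology. $\mathbb{N}^{\mathbb{N}}$ is the monoid of all functions $\mathbb{N}\to\mathbb{N}$ under composition (functions act on the right and compose from left to right), with the product topology arising from the discrete topology on $\mathbb{N}$. A topological embedding of a topological semigroup $S$ into a topological semigroup $T$ is an injective homomorphism $\phi:S\to T$ such that $\phi$ and $\phi^{-1}:(S)\phi\to S$ are continuous, where $(S)\phi$ has the subspace topology. *)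

(* Defs.v *)
From HB Require Import structures.
From mathcomp Require Import all_boot all_order all_algebra.
From mathcomp Require Import all_classical all_reals topology.

Set Implicit Arguments.
Unset Strict Implicit.
Unset Printing Implicit Defensive.

Local Open Scope classical_set_scope.
Local Open Scope group_scope.

HB.mixin Record isInverseSemigroup S of Semigroup S := {
  sinv : S -> S;
  mulgsVg : forall x : S, x * sinv x * x = x;
  mulsVgV : forall x : S, sinv x * x * sinv x = sinv x;
  sinv_unique : forall x y : S, x * y * x = x -> y * x * y = y -> y = sinv x
}.

#[short(type="inverseSemigroupType")]
HB.structure Definition InverseSemigroup :=
  {S of Semigroup S & isInverseSemigroup S}.

Definition clifford (S : inverseSemigroupType) :=
  forall x : S, x * sinv x = sinv x * x.

Definition idempotents (S : semigroupType) : set S := [set e | e * e = e].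

HB.structure Definition PreTopologicalSemigroup :=
  {S of Topological S & Semigroup S}.

HB.mixin Record isTopologicalSemigroup S of PreTopologicalSemigroup S := {
  mulg_continuous : continuous (fun xy : S * S => xy.1 * xy.2)
}.

#[short(type="topologicalSemigroupType")]
HB.structure Definition TopologicalSemigroup :=
  {S of PreTopologicalSemigroup S & isTopologicalSemigroup S}.

HB.structure Definition PreTopologicalInverseSemigroup :=
  {S of TopologicalSemigroup S & InverseSemigroup S}.

HB.mixin Record isTopologicalInverseSemigroup S
    of PreTopologicalInverseSemigroup S := {
  sinv_continuous : continuous (@sinv S)
}.

#[short(type="topologicalInverseSemigroupType")]
HB.structure Definition TopologicalInverseSemigroup :=
  {S of PreTopologicalInverseSemigroup S & isTopologicalInverseSemigroup S}.

(* [range phi] is coerced to [set_type (range phi)], which carries the subspace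
   topology; [psi] is the inverse of the corestriction of [phi]. *)
Definition topological_embedding (S T : topologicalSemigroupType)
    (phi : S -> T) :=
  [/\ injective phi,
      {morph phi : x y / x * y},
      continuous phi
    & exists psi : range phi -> S,
        (forall y : range phi, phi (psi y) = set_val y) /\ continuous psi].

Definition separable (T : topologicalType) :=
  exists2 D : set T, countable D & dense D.

Definition homeomorphism (T U : topologicalType) (f : T -> U) :=
  continuous f /\
  exists g : U -> T, [/\ cancel f g, cancel g f & continuous g].

(* [completeType] is not used here because it only covers pointed spaces. *)
Definition complete_uniform (T : uniformType) :=
  forall F : set_system T, ProperFilter F -> cauchy F ->
    exists x : T, F --> x.

Definition completely_metrizable (R : realType) (T : topologicalType) :=
  exists (M : metricType R) (f : T -> M), complete_uniform M /\ homeomorphism f.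

Definition polish (R : realType) (T : topologicalType) :=
  separable T /\ completely_metrizable R T.

(* Functions act on the right, so the product [f * g] is "[f], then [g]". *)
Definition nat_maps : Type := {ptws nat -> nat}.

HB.instance Definition _ := Topological.on nat_maps.

Section nat_maps_monoid.

Let mul (f g : nat_maps) : nat_maps := fun n => g (f n).
Let one : nat_maps := fun n => n.

Let mulA : associative mul. Proof. by []. Qed.
Let mul1 : left_id one mul. Proof. by []. Qed.
Let mulr1 : right_id one mul. Proof. by []. Qed.

HB.instance Definition _ := isMonoid.Build nat_maps mulA mul1 mulr1.

End nat_maps_monoid.

Lemma nat_maps_mulE (f g : nat_maps) (n : nat) : (f * g) n = g (f n).
Proof. by []. Qed.

Lemma nbhs_nat_maps_eq (f : nat_maps) (n : nat) :
  nbhs f [set g : nat_maps | g n = f n].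
Proof.
have fn : nbhs (f n) [set f n] by exact: discrete_set1.
exact: (@proj_continuous nat (fun=> nat) n f _ fn).
Qed.

Lemma nat_maps_mul_continuous :
  continuous (fun fg : nat_maps * nat_maps => fg.1 * fg.2).
Proof.
move=> [f g]; apply/cvg_sup => n A [B [[W oW <-] Wx sub]].
apply: filterS sub _; exists ([set h : nat_maps | h n = f n],
                              [set h : nat_maps | h (f n) = g (f n)]).
  by split; exact: nbhs_nat_maps_eq.
by move=> [f' g'] [/= fE gE]; rewrite nat_maps_mulE fE gE.
Qed.

HB.instance Definition _ :=
  isTopologicalSemigroup.Build nat_maps nat_maps_mul_continuous.

(* Main.v *)
Require Import Defs.
From HB Require Import structures.
From mathcomp Require Import all_boot all_order all_algebra.
From mathcomp Require Import all_classical all_reals topology.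
From mathcomp Require Import zify.

(** Write [G] for the additive group of polynomials over the two-element field.
    The semigroup is a chain of copies of [G], indexed by the natural numbers
    and continued downwards by a zero: the structure map from copy [n] to copy
    [n + 1] is division by ['X] with remainder dropped, and two elements are
    multiplied by sending both to the lower of their copies and adding there.
    Every such chain of abelian groups is a commutative Clifford semigroup, and
    since [G] has exponent two each element is its own inverse.

    All elements except zero are isolated, and the neighbourhoods of zero are
    the sets that contain zero and almost all of the idempotents
    [e_n = (n, 0)].  So the space is a convergent sequence, which consists of
    the idempotents, together with countably many isolated points; this is why
    it is locally compact and Polish with a compact set of idempotents.  The
    product is continuous because a polynomial [p] is annihilated by
    [size p] structure maps: for fixed [x], [e_n * x] is the idempotent [e_n]
    as soon as [n] is large.

    How large depends on [x], and that rules out an embedding into the monoid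
    of maps of the natural numbers.  In that monoid, if [f_n] converges to [f]
    then for each point [k] eventually [f_n] and [f] agree at [k], and hence so
    do [f_n * g_n] and [f * g_n], uniformly over all [g_n].  Consequently, in a
    semigroup that embeds, [e_n] tending to [a] and [a * x_n = b] for all [n]
    force [e_n * x_n] to tend to [b] (lemma [embedding_nat_maps_cvg_mul]).
    Here [e_n] tends to zero and [x_n = (0, 'X^n)] is absorbed by zero, but
    [e_n * x_n = (n, 1)] is not idempotent and stays away from zero. *)

Local Open Scope classical_set_scope.
Local Open Scope group_scope.

Import Order.TTheory GRing.Theory Num.Theory.

(** * Semigroups that embed in the monoid of maps of the natural numbers *)

Lemma nat_maps_cvg (F : set_system nat_maps) (f : nat_maps) : Filter F ->
  (forall k, \forall g \near F, g k = f k) -> F --> f.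
Proof.
move=> FF Ff; apply/cvg_sup => k A [B [[W oW <-] Wx sub]].
by apply: filterS sub _; apply: filterS (Ff k) => g /= gk; rewrite /= gk.
Qed.

(** At a given point [k], the value of [phi (e n * x n)] is that of [phi (x n)]
    at [phi (e n) k], and [phi (e n) k] is eventually constant.  The threshold
    depends on [k] but not on the sequence [x], on which no convergence
    assumption is made. *)
Lemma embedding_nat_maps_cvg_mul (S : topologicalSemigroupType)
    (phi : S -> nat_maps) (e x : nat -> S) (a b : S) :
  topological_embedding phi -> e n @[n --> \oo] --> a ->
  (forall n, a * x n = b) -> e n * x n @[n --> \oo] --> b.
Proof.
move=> [inj_phi phiM phiC [psi [psiK psiC]]] ea axb.
pose im (s : S) : range phi := SigSub (mem_set (imageT phi s)).
have imK s : psi (im s) = s by apply: inj_phi; rewrite psiK.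
rewrite -[X in _ --> X]imK.
rewrite (_ : (fun n => e n * x n) = psi \o (fun n => im (e n * x n)));
  last by apply/funext => n /=; rewrite imK.
apply: cvg_comp (psiC (im b)).
suff imex : phi (e n * x n) @[n --> \oo] --> phi b.
  move=> A [B [[W oW <-] Wb sub]].
  have nW : nbhs (phi b) W by rewrite nbhsE; exists W.
  apply: (@filterS _ \oo _ (fun n => W (phi (e n * x n)))) (imex W nW) => n Wn.
  exact: sub.
apply: nat_maps_cvg => k.
have : \forall n \near \oo, phi (e n) k = phi a k.
  exact: (cvg_comp _ _ ea (phiC a)) (nbhs_nat_maps_eq (phi a) k).
apply: filterS => n ek.
by rewrite /= phiM nat_maps_mulE ek -nat_maps_mulE -phiM axb.
Qed.

(** * The semigroup *)

(** [Some (n, p)] is the element [p] of the [n]-th group, [None] the zero.  The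
    parameter [R] is a phantom for the algebra; it is there so that the carrier
    can be given an [R]-valued distance, from which its topology is derived. *)
Definition shift_semigroup (R : realType) : Type := option (nat * {poly 'F_2}).

Section ShiftSemigroup.
Context (R : realType).
Local Notation S := (shift_semigroup R).
Local Notation elt n p := (Some (n, p) : S).
Local Notation zero := (None : S).
Implicit Types (x y z : S) (n m k : nat) (p q r : {poly 'F_2}).

HB.instance Definition _ := Countable.on S.

(** Subtraction is truncated: [m - n] is the number of levels by which an
    element of level [n] has to descend to reach level [maxn n m]. *)
Definition shift_mul x y : S :=
  match x, y with
  | Some (n, p), Some (m, q) =>
      Some (maxn n m, drop_poly (m - n) p + drop_poly (n - m) q)%R
  | _, _ => None
  end.

Lemma drop_poly_drop n m p : drop_poly n (drop_poly m p) = drop_poly (n + m) p.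
Proof. by apply/polyP => i; rewrite !coef_drop_poly addnA. Qed.

Lemma addpp_F2 p : (p + p = 0)%R.
Proof. by apply: addrr_pchar2; rewrite pchar_poly pchar_Fp. Qed.

Lemma shift_mulC : commutative shift_mul.
Proof. by move=> [[n p]|] [[m q]|] //=; rewrite maxnC addrC. Qed.

Lemma shift_mulA : associative shift_mul.
Proof.
move=> [[n p]|] [[m q]|] [[k r]|] //=.
rewrite maxnA !drop_polyD !drop_poly_drop addrA.
by congr (Some (_, _ + _ + _)%R); congr (drop_poly _ _); lia.
Qed.

HB.instance Definition _ := isSemigroup.Build S shift_mulA.

Lemma mul_elt n m p q :
  elt n p * elt m q =
  Some (maxn n m, drop_poly (m - n) p + drop_poly (n - m) q)%R.
Proof. by []. Qed.

Lemma shift_cube x : x * x * x = x.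
Proof.
case: x => [[n p]|] //.
by rewrite !mul_elt !maxnn subnn !drop_poly0l addpp_F2 add0r.
Qed.

(** Formal from commutativity and [x ^+ 3 = x]: the two hypotheses turn into
    [x * x * y = x] and [y * y * x = y], so that
    [y = y * y * x = y ^+ 3 * x * x = y * x * x = x]. *)
Lemma shift_inv_unique x y : x * y * x = x -> y * x * y = y -> y = x.
Proof.
have C (u v : S) : u * v = v * u by exact: shift_mulC.
move=> xyx yxy.
have yxx : y * x * x = x by rewrite (C y x).
have xyy : x * y * y = y by rewrite (C x y).
rewrite -[LHS]xyy -{1}yxx (C _ y) (C (y * x * x) y) !mulgA.
by rewrite shift_cube.
Qed.

HB.instance Definition _ := isInverseSemigroup.Build S
  shift_cube shift_cube shift_inv_unique.

(** * The topology *)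

(** The distance between two different points is the larger of their weights.
    Zero is the only point of weight zero, so every other point is isolated, and
    the ball of radius at most one around zero contains only zero and
    idempotents. *)
Definition weight x : R :=
  match x with
  | None => 0
  | Some (n, p) => if p == 0 then n.+1%:R^-1 else 1
  end%R.

Lemma weight_gt0 n p : (0 < weight (elt n p))%R.
Proof. by rewrite /weight; case: ifP => _; rewrite ?ltr01// invr_gt0 ltr0n. Qed.

Lemma weight_ge0 x : (0 <= weight x)%R.
Proof. by case: x => [[n p]|] //; exact/ltW/weight_gt0. Qed.

Definition shift_dist x y : R :=
  if x == y then 0%R else Num.max (weight x) (weight y).

Lemma shift_distxx x : shift_dist x x = 0%R.
Proof. by rewrite /shift_dist eqxx. Qed.

Lemma shift_dist_eq0 x y : shift_dist x y = 0%R -> x = y.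
Proof.
rewrite /shift_dist; case: eqP => // _ max0.
have wx : (weight x <= 0)%R by rewrite -max0 le_max lexx.
have wy : (weight y <= 0)%R by rewrite -max0 le_max lexx orbT.
case: x wx {max0} => [[n p]|]; first by rewrite leNgt weight_gt0.
by case: y wy => [[m q]|] //; rewrite leNgt weight_gt0.
Qed.

Lemma shift_dist_sym x y : shift_dist x y = shift_dist y x.
Proof. by rewrite /shift_dist eq_sym maxC. Qed.

Lemma shift_dist_triangle y x z :
  (shift_dist x z <= shift_dist x y + shift_dist y z)%R.
Proof.
have wx := weight_ge0 x; have wy := weight_ge0 y; have wz := weight_ge0 z.
rewrite /shift_dist.
have [<-|xy] := eqVneq x y; first by rewrite add0r.
have [<-|yz] := eqVneq y z; first by rewrite (negbTE xy) addr0.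
case: eqP => _; first by rewrite addr_ge0// le_max ?wx ?wy.
by rewrite ge_max; apply/andP; split;
  [rewrite ler_wpDr | rewrite ler_wpDl]; rewrite ?le_max ?lexx ?wy ?orbT.
Qed.

HB.instance Definition _ := isMetric.Build R S
  shift_distxx shift_dist_eq0 shift_dist_sym shift_dist_triangle.

Definition idem n : S := Some (n, 0%R).

Lemma ball_shiftE x e : ball x e = [set y | (shift_dist x y < e)%R].
Proof. by rewrite ballEmdist. Qed.

Lemma ball_shift_sub x e y :
  ball x e y -> y = x \/ (weight x < e /\ weight y < e)%R.
Proof.
rewrite ball_shiftE /= /shift_dist; case: eqP => [->|_]; first by left.
by rewrite gt_max => /andP[? ?]; right.
Qed.

Lemma nbhs_elt n p : nbhs (elt n p) [set elt n p].
Proof.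
apply/nbhs_ballP; exists (weight (elt n p)); first exact: weight_gt0.
by move=> y /ball_shift_sub[//|[]]; rewrite ltxx.
Qed.

Lemma nbhs_zeroP (A : set S) :
  nbhs zero A <-> A None /\ \forall n \near \oo, A (idem n).
Proof.
split=> [NA|[A0 [N _ AN]]].
  split; first exact: (nbhs_singleton NA).
  have /nbhs_ballP[e /= e0 sub] := NA.
  exists (Num.bound e^-1) => // n Nn; apply: sub.
  rewrite ball_shiftE /= /shift_dist /= gt_max e0 eqxx.
  rewrite invf_plt ?posrE ?ltr0n//.
  apply: lt_le_trans (archi_boundP _) _; first by rewrite invr_ge0 ltW.
  by rewrite ler_nat ltnW.
apply/nbhs_ballP; exists N.+1%:R^-1%R; first by rewrite /= invr_gt0 ltr0n.
move=> y /ball_shift_sub[-> //|[_]].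
case: y => [[n p]|] //=; case: eqP => [->|_].
  rewrite ltf_pV2 ?posrE ?ltr0n// ltr_nat ltnS => Nn.
  by apply: AN; rewrite /= ltnW.
by rewrite ltNge invf_le1 ?ltr0n// ler1n.
Qed.

Lemma cvg_idem : idem n @[n --> \oo] --> zero.
Proof. by move=> A /nbhs_zeroP[]. Qed.

(** The case that uses the structure of the semigroup is that of an isolated
    point [(n, p)] times zero, where [(n, p) * e_m] is [e_m] for all
    [m >= n + size p]. *)
Lemma shift_mul_continuous : continuous (fun xy : S * S => xy.1 * xy.2).
Proof.
have side n p (A : set S) : nbhs zero A ->
    nbhs zero [set y : S | A (elt n p * y)].
  move=> /nbhs_zeroP[A0 [N _ AN]]; apply/nbhs_zeroP; split=> //.
  exists (maxn N (n + size p)) => // m /=; rewrite geq_max => /andP[Nm pm].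
  rewrite mul_elt drop_poly0r addr0 drop_poly_eq0;
    last by rewrite -(addKn n (size p)) leq_sub2r.
  by rewrite (maxn_idPr _); [exact: AN | exact: leq_trans (leq_addr _ _) pm].
move=> [x y] A /=; case: x => [[n p]|]; case: y => [[m q]|] => NA.
- exists ([set elt n p], [set elt m q]); first by split; exact: nbhs_elt.
  by move=> [_ _] [/= -> ->]; exact: nbhs_singleton NA.
- exists ([set elt n p], [set y : S | A (elt n p * y)]).
    by split; [exact: nbhs_elt | exact: side].
  by move=> [_ y] [/= ->].
- exists ([set x : S | A (elt m q * x)], [set elt m q]).
    by split; [exact: side | exact: nbhs_elt].
  by move=> [x _] [/= Ax ->]; rewrite [_ * _]shift_mulC.
(* Zero times zero: a tail of the sequence of idempotents, with zero added,
   is closed under products because [e_n * e_m = e_(maxn n m)]. *)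
- have /nbhs_zeroP[A0 [N _ AN]] := NA.
  pose B : set S := [set x | x = None \/ exists2 n, (N <= n)%N & x = idem n].
  have NB : nbhs zero B.
    apply/nbhs_zeroP; split; first by left.
    by exists N => // n Nn; right; exists n.
  exists (B, B) => // -[_ _] [/= [->|[n Nn ->]] [->|[m Nm ->]]] //.
  rewrite mul_elt !drop_poly0r addr0; apply: AN => /=.
  by rewrite leq_max Nn.
Qed.

HB.instance Definition _ := isTopologicalSemigroup.Build S shift_mul_continuous.

Lemma shift_inv_continuous : continuous (@sinv S).
Proof. by move=> x; exact: cvg_id. Qed.

HB.instance Definition _ :=
  isTopologicalInverseSemigroup.Build S shift_inv_continuous.

Lemma idempotents_shiftE :
  @idempotents S = [set x | x = None \/ exists n, x = idem n].
Proof.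
apply/seteqP; split=> x; rewrite /idempotents /=.
  case: x => [[n p]|]; last by left.
  rewrite mul_elt subnn maxnn addpp_F2 => -[<-]; by right; exists n.
by move=> [->|[n ->]] //; rewrite mul_elt subnn maxnn addpp_F2.
Qed.

Lemma nbhs_idempotents : nbhs zero (@idempotents S).
Proof.
rewrite idempotents_shiftE; apply/nbhs_zeroP; split; first by left.
by exists 0%N => // n _; right; exists n.
Qed.

(** If zero is not a cluster point of a filter on the idempotents, then some
    member of the filter meets only finitely many of them, and finite sets are
    compact. *)
Lemma compact_idempotents : compact (@idempotents S).
Proof.
move=> F FF; rewrite idempotents_shiftE => FE.
have [clN|nclN] := pselect (cluster F zero).
  by exists None; split=> //; left.
have [A FA [B /nbhs_zeroP[B0 [N _ BN]] AB0]] :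
    exists2 A, F A & exists2 B, nbhs zero B & A `&` B = set0.
  apply: contrapT => noAB; apply: nclN => A B FA NB.
  by apply/set0P/eqP => AB0; apply: noAB; exists A => //; exists B.
have cptN : compact [set idem n | n in `I_N].
  exact/finite_compact/finite_image/finite_II.
have [|x [[n _ <-] clx]] := cptN F FF.
- apply: filterS (filterI FE FA) => x [] [->|[n ->]] Ax.
    by have : (A `&` B) None by []; rewrite AB0.
  exists n => //=; rewrite ltnNge; apply/negP => Nn.
  have : (A `&` B) (idem n) by split=> //; exact: BN.
  by rewrite AB0.
- exists (idem n); split=> //; by right; exists n.
Qed.

Lemma shift_hausdorff : hausdorff_space S.
Proof. exact: metric_hausdorff. Qed.

Lemma shift_locally_compact : locally_compact [set: S].
Proof.
move=> [[n p]|] _; rewrite withinET.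
- exists [set elt n p]; first exact: nbhs_elt.
  split; first exact: compact_set1.
  exact: (compact_closed shift_hausdorff (@compact_set1 S _)).
- exists (@idempotents S); first exact: nbhs_idempotents.
  split; first exact: compact_idempotents.
  by apply: (compact_closed shift_hausdorff); exact: compact_idempotents.
Qed.

(** A ball is a singleton unless its radius exceeds the weight of its centre,
    in which case it lies in the ball of the same radius around zero.  So a
    Cauchy filter either contains a singleton or converges to zero. *)
Lemma shift_complete : complete_uniform S.
Proof.
move=> F FF /cauchyP cF.
have [[x Fx]|noF] := pselect (exists x, F [set x]).
  by exists x => A /nbhs_singleton Ax; apply: filterS Fx => _ ->.
exists None => A /nbhs_ballP[e /= e0 sub].
have [x Fx] := cF e e0.
have [wx|wx] := ltP (weight x) e; last first.
  exfalso; apply: noF; exists x; apply: filterS Fx => y.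
  by move=> /ball_shift_sub[//|[]]; rewrite ltNge wx.
apply: filterS Fx => y yx; apply: sub.
have wy : (weight y < e)%R by case: (ball_shift_sub _ _ _ yx) => [->|[]].
rewrite ball_shiftE /= /shift_dist; case: eqP => // _.
by rewrite gt_max wy e0.
Qed.

Lemma shift_polish : polish R S.
Proof.
split; last first.
  exists S, id; split; first exact: shift_complete.
  by split; [move=> x; exact: cvg_id | exists id; split=> // x; exact: cvg_id].
exists setT; first exact: countableP.
by move=> U [x Ux] _; exists x.
Qed.

(** * Failure of embeddability *)

Lemma shift_not_embeddable (phi : S -> nat_maps) : ~ topological_embedding phi.
Proof.
move=> emb; pose x n : S := elt 0%N 'X^n%R.
have := @embedding_nat_maps_cvg_mul S phi idem x None None emb cvg_idem
  (fun=> erefl).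
(* The idempotents form a neighbourhood of zero, which the products
   [idem n * x n] would eventually enter. *)
move=> /(_ _ nbhs_idempotents)[N _ /(_ N (leqnn N))] /=.
rewrite idempotents_shiftE => -[//|[n]].
rewrite mul_elt subn0 drop_poly0r add0r.
rewrite -['X^N%R]mul1r drop_polyMXn_id => -[_ /eqP].
by rewrite oner_eq0.
Qed.

End ShiftSemigroup.

Theorem proposition4p6 (R : realType) :
  exists S : topologicalInverseSemigroupType,
    [/\ countable [set: S],
        (forall x y : S, x * y = y * x),
        clifford S
      & hausdorff_space S] /\
    [/\ locally_compact [set: S] /\ polish R S,
        compact (@idempotents S)
      & ~ exists phi : S -> nat_maps, topological_embedding phi].
Proof.
exists (shift_semigroup R); split; split.
- exact: countableP.
- exact: shift_mulC.
- by [].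
- exact: shift_hausdorff.
- by split; [exact: shift_locally_compact | exact: shift_polish].
- exact: compact_idempotents.
- by move=> [phi]; exact: shift_not_embeddable.
Qed.
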